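(* Let $G$ be a finitely presented group. Suppose that there exists a sequence $G_1\ge G_2\ge\cdots$ of finite index subgroups of $G$, each normal in $G_1$, such that (i) $G_i/G_{i+1}$ is abelian for all $i\ge 1$; (ii) $\lim_{i\to\infty} \frac{\log [G_i:G_{i+1}]}{[G:G_i]}=\infty$; (iii) $\limsup_{i} \frac{d(G_i/G_{i+1})}{[G:G_i]}>0$. Then $G_i$ is a non-trivial graph of groups for all sufficiently large $i$.
   Context: For a finitely generated group $H$, $d(H)$ denotes the minimal size of a generating set of $H$. A group is a non-trivial graph of groups if it admits a non-trivial decomposition as a graph of groups; equivalently, it is isomorphic either to an amalgamated free product $P*_R Q$ with $R$ a proper subgroup of both $P$ and $Q$, or to an HNN extension $P*_R$. *)

(* Defs.v *)
From HB Require Import structures.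
From mathcomp Require Import all_boot all_order all_algebra finmap.
From mathcomp Require Import all_classical all_reals all_analysis.

Set Implicit Arguments.
Unset Strict Implicit.
Unset Printing Implicit Defensive.

Import Order.TTheory GRing.Theory Num.Theory.
Import numFieldNormedType.Exports.

Local Open Scope classical_set_scope.
Local Open Scope group_scope.
Local Open Scope quotient_scope.

(* Groups are possibly infinite [groupType]s; a subgroup of [G] is a predicate
   [H : groupClosed G], coerced to a group in its own right. *)
Section SubgroupType.
Variables (G : groupType) (H : groupClosed G).

Definition subgroup_type := {x : G | x \in H}.

HB.instance Definition _ := SubChoice.on subgroup_type.

Fact subgroup_closed : group_closed (fun x : G => x \in H).
Proof. by split=> [|x y Hx Hy]; [exact: gpred1 | exact: gpredF]. Qed.

HB.instance Definition _ :=
  SubChoice_isSubGroup.Build G (fun x : G => x \in H) subgroup_type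
    subgroup_closed.
End SubgroupType.

Coercion subgroup_type : GroupClosed.type >-> Sortclass.

Definition normal_in (G : groupType) (N H : {pred G}) : Prop :=
  {subset N <= H} /\ {in N & H, forall x h, x ^ h \in N}.

Definition lcosets (G : groupType) (H K : {pred G}) : set (set G) :=
  [set [set x * k | k in [set` K]] | x in [set` H]].

(* [0] when there are infinitely many cosets. *)
Definition subgroup_index (G : groupType) (H K : {pred G}) : nat :=
  #|` fset_set (lcosets H K)|.

Definition finite_index (G : groupType) (K : {pred G}) : Prop :=
  finite_set (lcosets predT K).

Definition group_isomorphic (G H : groupType) : Prop :=
  exists f : {multiplicative G -> H}, bijective f.

Definition abelian_group (G : groupType) : Prop :=
  forall x y : G, x * y = y * x.

Definition normal_closure (G : groupType) (S : set G) : set G :=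
  [set x | forall N : groupClosed G,
     normal_in N predT -> S `<=` [set` N] -> x \in N].

(* The quotient of [G] by the normal closure of [S], so that it makes sense for
   every [S]; [gquot_piE] below says that it is the usual quotient [G / N] when
   [S] is a normal subgroup [N]. *)
Section Quotient.
Variables (G : groupType) (S : set G).

Let nc := normal_closure S.

Let nc1 : nc 1. Proof. by move=> N _ _; exact: gpred1. Qed.

Let ncM x y : nc x -> nc y -> nc (x * y).
Proof. by move=> ncx ncy N nN SN; apply: gpredM; [exact: ncx|exact: ncy]. Qed.

Let ncV x : nc x -> nc x^-1.
Proof. by move=> ncx N nN SN; apply: gpredVr; exact: ncx. Qed.

Let ncJ x g : nc x -> nc (x ^ g).
Proof. by move=> ncx N nN SN; apply: nN.2 => //; exact: ncx. Qed.

Definition gquot_rel : rel G := fun x y => `[< normal_closure S (x^-1 * y) >].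

Let gquot_refl : reflexive gquot_rel.
Proof. by move=> x; apply/asboolP; rewrite mulVg. Qed.

Let gquot_sym : symmetric gquot_rel.
Proof.
suff sym x y : gquot_rel x y -> gquot_rel y x.
  by move=> x y; apply/idP/idP; exact: sym.
by move=> /asboolP/ncV; rewrite invgM invgK => ?; exact/asboolP.
Qed.

Let gquot_trans : transitive gquot_rel.
Proof.
move=> y x z /asboolP xy /asboolP yz; apply/asboolP.
by have := ncM xy yz; rewrite mulgA mulgK.
Qed.

Definition gquot_equiv := EquivRel gquot_rel gquot_refl gquot_sym gquot_trans.

Definition gquot := {eq_quot gquot_equiv}.

HB.instance Definition _ := Choice.on gquot.
HB.instance Definition _ := EqQuotient.on gquot.

Let gq (x : G) : gquot := \pi x.

Let gqP x y : gq x = gq y <-> nc (x^-1 * y).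
Proof.
split=> [/eqP|?]; first by rewrite eqmodE => /asboolP.
by apply/eqP; rewrite eqmodE; exact/asboolP.
Qed.

Let gq_reprK (a : gquot) : gq (repr a) = a. Proof. exact: reprK. Qed.

Let gqM x x' y y' : gq x = gq x' -> gq y = gq y' -> gq (x * y) = gq (x' * y').
Proof.
move=> /gqP xx' /gqP yy'; apply/gqP.
have := ncM (ncJ y xx') yy'; rewrite /conjg invgM -!mulgA.
by rewrite mulVKg.
Qed.

Let gqV x x' : gq x = gq x' -> gq x^-1 = gq x'^-1.
Proof.
move=> /esym/gqP xx'; apply/gqP.
by have := ncJ x'^-1 xx'; rewrite /conjg !invgK -!mulgA mulVKg.
Qed.

Definition gquot_one : gquot := \pi_gquot 1.
Definition gquot_inv (a : gquot) : gquot := \pi_gquot (repr a)^-1.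
Definition gquot_mul (a b : gquot) : gquot := \pi_gquot (repr a * repr b).

Let mulE x y : gquot_mul (gq x) (gq y) = gq (x * y).
Proof. by apply: gqM; exact: gq_reprK. Qed.

Let invE x : gquot_inv (gq x) = gq x^-1.
Proof. by apply: gqV; exact: gq_reprK. Qed.

Let gquot_mulA : associative gquot_mul.
Proof.
by move=> a b c; rewrite -(gq_reprK a) -(gq_reprK b) -(gq_reprK c) !mulE mulgA.
Qed.

Let gquot_mul1g : left_id gquot_one gquot_mul.
Proof. by move=> a; rewrite -(gq_reprK a) mulE mul1g. Qed.

Let gquot_mulg1 : right_id gquot_one gquot_mul.
Proof. by move=> a; rewrite -(gq_reprK a) mulE mulg1. Qed.

Let gquot_mulVg : left_inverse gquot_one gquot_inv gquot_mul.
Proof. by move=> a; rewrite -(gq_reprK a) invE mulE mulVg. Qed.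

Let gquot_mulgV : right_inverse gquot_one gquot_inv gquot_mul.
Proof. by move=> a; rewrite -(gq_reprK a) invE mulE mulgV. Qed.

HB.instance Definition _ := isGroup.Build gquot
  gquot_mulA gquot_mul1g gquot_mulg1 gquot_mulVg gquot_mulgV.

Definition gquot_pi (x : G) : gquot := \pi_gquot x.

Lemma gquot_piM x y : gquot_pi (x * y) = gquot_pi x * gquot_pi y.
Proof. exact/esym/mulE. Qed.

Lemma gquot_pi_surj a : exists x, gquot_pi x = a.
Proof. by exists (repr a); exact: reprK. Qed.

Lemma gquot_piP x y :
  gquot_pi x = gquot_pi y <-> normal_closure S (x^-1 * y).
Proof. exact: gqP. Qed.
End Quotient.

Lemma gquot_piE (G : groupType) (N : groupClosed G) (x y : G) :
  normal_in N predT ->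
  gquot_pi [set` N] x = gquot_pi [set` N] y <-> x^-1 * y \in N.
Proof.
move=> nN; split=> [/gquot_piP/(_ N nN)|xyN]; first exact.
by apply/gquot_piP => M _; exact.
Qed.

(* Words in the letters [(b, x)], where [b = true] stands for [x^-1]. *)
Definition word (X : choiceType) := seq (bool * X).

Inductive free_equiv (X : choiceType) : word X -> word X -> Prop :=
| FreeRefl w : free_equiv w w
| FreeSym v w : free_equiv v w -> free_equiv w v
| FreeTrans u v w : free_equiv u v -> free_equiv v w -> free_equiv u w
| FreeCancel u b x v : free_equiv (u ++ [:: (b, x), (~~ b, x) & v]) (u ++ v).

Section FreeGroup.
Variable X : choiceType.

Definition free_rel : rel (word X) := fun v w => `[< free_equiv v w >].

Let free_refl : reflexive free_rel.
Proof. by move=> w; apply/asboolP; exact: FreeRefl. Qed.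

Let free_sym : symmetric free_rel.
Proof.
by move=> v w; apply/idP/idP => /asboolP vw; apply/asboolP; exact: FreeSym.
Qed.

Let free_trans : transitive free_rel.
Proof.
by move=> v u w /asboolP uv /asboolP vw; apply/asboolP; exact: FreeTrans vw.
Qed.

Definition free_eqrel := EquivRel free_rel free_refl free_sym free_trans.

Definition free_group := {eq_quot free_eqrel}.

HB.instance Definition _ := Choice.on free_group.
HB.instance Definition _ := EqQuotient.on free_group.

Definition winv (w : word X) : word X := rev [seq (~~ a.1, a.2) | a <- w].

Let fg (w : word X) : free_group := \pi w.

Let fgP (v w : word X) : fg v = fg w <-> free_equiv v w.
Proof.
split=> [/eqP|?]; first by rewrite eqmodE => /asboolP.
by apply/eqP; rewrite eqmodE; exact/asboolP.
Qed.

Let fg_reprK (a : free_group) : fg (repr a) = a. Proof. exact: reprK. Qed.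

Let catl (u v w : word X) : free_equiv v w -> free_equiv (u ++ v) (u ++ w).
Proof.
elim=> {v w} [w|v w _|v w z _ + _|v b x w];
  [exact: FreeRefl|exact: FreeSym|exact: FreeTrans|].
by rewrite !catA; exact: FreeCancel.
Qed.

Let catr (u v w : word X) : free_equiv v w -> free_equiv (v ++ u) (w ++ u).
Proof.
elim=> {v w} [w|v w _|v w z _ + _|v b x w];
  [exact: FreeRefl|exact: FreeSym|exact: FreeTrans|].
by rewrite -!catA; exact: FreeCancel.
Qed.

Let winv_equiv (v w : word X) : free_equiv v w -> free_equiv (winv v) (winv w).
Proof.
elim=> {v w} [w|v w _|v w z _ + _|v b x w];
  [exact: FreeRefl|exact: FreeSym|exact: FreeTrans|].
rewrite /winv !map_cat !rev_cat /= !rev_cons -!cats1 -!catA /=.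
by rewrite negbK; exact: FreeCancel.
Qed.

Let winvK : involutive winv.
Proof.
move=> w; rewrite /winv map_rev revK -map_comp -[RHS]map_id.
by apply: eq_map => -[b x] /=; rewrite negbK.
Qed.

Let winvV (w : word X) : free_equiv (winv w ++ w) [::].
Proof.
elim: w => [|[b x] w IHw]; first exact: FreeRefl.
rewrite /winv /= rev_cons -cats1 -catA /=.
apply: FreeTrans IHw; rewrite -{2}(negbK b); exact: FreeCancel.
Qed.

Definition free_one : free_group := \pi_free_group [::].
Definition free_inv (a : free_group) : free_group := \pi_free_group (winv (repr a)).
Definition free_mul (a b : free_group) : free_group :=
  \pi_free_group (repr a ++ repr b).

Let mulE v w : free_mul (fg v) (fg w) = fg (v ++ w).
Proof.
apply/fgP; apply: FreeTrans (catr _ _) (catl _ _); exact/fgP/fg_reprK.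
Qed.

Let invE w : free_inv (fg w) = fg (winv w).
Proof. by apply/fgP/winv_equiv/fgP/fg_reprK. Qed.

Let free_mulA : associative free_mul.
Proof.
by move=> a b c; rewrite -(fg_reprK a) -(fg_reprK b) -(fg_reprK c) !mulE catA.
Qed.

Let free_mul1g : left_id free_one free_mul.
Proof. by move=> a; rewrite -(fg_reprK a) mulE. Qed.

Let free_mulg1 : right_id free_one free_mul.
Proof. by move=> a; rewrite -(fg_reprK a) mulE cats0. Qed.

Let free_mulVg : left_inverse free_one free_inv free_mul.
Proof. by move=> a; rewrite -(fg_reprK a) invE mulE; exact/fgP/winvV. Qed.

Let free_mulgV : right_inverse free_one free_inv free_mul.
Proof.
move=> a; rewrite -(fg_reprK a) invE mulE; apply/fgP.
by rewrite -{1}(winvK (repr a)); exact: winvV.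
Qed.

HB.instance Definition _ := isGroup.Build free_group
  free_mulA free_mul1g free_mulg1 free_mulVg free_mulgV.

Definition free_gen (x : X) : free_group := \pi_free_group [:: (false, x)].
End FreeGroup.

Definition finitely_presented (G : groupType) : Prop :=
  exists (n : nat) (r : seq (free_group 'I_n)),
    group_isomorphic G (gquot [set` r]).

Definition generates (G : groupType) (A : {pred G}) : Prop :=
  forall H : groupClosed G, {subset A <= H} -> forall x, x \in H.

Definition has_generators (G : groupType) (n : nat) : Prop :=
  exists2 A : {fset G}, generates (mem A) & #|` A| = n.

(* The minimal size of a generating set, and [0] by convention if [G] is not
   finitely generated. *)
Definition grank (G : groupType) : nat :=
  if pselect (exists n, `[< has_generators G n >]) is left ex_gen
  then ex_minn ex_gen else 0.

(* [P *_R Q] for the monomorphisms [i : R -> P] and [j : R -> Q]: generated by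
   the elements of [P] and [Q], subject to the multiplication tables of [P] and
   [Q] and to [i r = j r]. *)
Section Amalgam.
Variables (P Q R : groupType) (i : R -> P) (j : R -> Q).

Let inP (p : P) := free_gen (inl p : P + Q).
Let inQ (q : Q) := free_gen (inr q : P + Q).

Definition amalgam_relators : set (free_group (P + Q)%type) :=
  [set inP pp.1 * inP pp.2 / inP (pp.1 * pp.2) | pp in [set: P * P]] `|`
  [set inQ qq.1 * inQ qq.2 / inQ (qq.1 * qq.2) | qq in [set: Q * Q]] `|`
  [set inP (i r) / inQ (j r) | r in [set: R]].

Definition amalgam := gquot amalgam_relators.

HB.instance Definition _ := Group.on amalgam.
End Amalgam.

(* [P *_R] for the monomorphisms [i, j : R -> P]: generated by the elements of
   [P] and a stable letter [t], subject to the multiplication table of [P] and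
   to [t (i r) t^-1 = j r]. *)
Section HNN.
Variables (P R : groupType) (i j : R -> P).

Let inP (p : P) := free_gen (inl p : P + unit).
Let t := free_gen (inr tt : P + unit).

Definition hnn_relators : set (free_group (P + unit)%type) :=
  [set inP pp.1 * inP pp.2 / inP (pp.1 * pp.2) | pp in [set: P * P]] `|`
  [set t * inP (i r) * t^-1 / inP (j r) | r in [set: R]].

Definition hnn_extension := gquot hnn_relators.

HB.instance Definition _ := Group.on hnn_extension.
End HNN.

Definition nontrivial_graph_of_groups (G : groupType) : Prop :=
  (exists (P Q R : groupType)
     (i : {multiplicative R -> P}) (j : {multiplicative R -> Q}),
     [/\ injective i, injective j, range i `<` [set: P], range j `<` [set: Q]
       & group_isomorphic G (amalgam i j)])
  \/
  (exists (P R : groupType) (i j : {multiplicative R -> P}),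
     [/\ injective i, injective j & group_isomorphic G (hnn_extension i j)]).

(* [H / K], when [K] is a normal subgroup of [H]. *)
Definition subquotient (G : groupType) (H K : groupClosed G) : groupType :=
  gquot [set x : H | val x \in K].

(* Main.v *)
(* Hypothesis (ii) alone makes the first Betti number of [G_ i] positive for
   large [i]. Let [H] have index [d] in [G = <s_1 .. s_n | rs>], with relators of
   length at most [L]. Label the [n d] edges of the coset graph of [H] by elements
   of an abelian group [A], so that the sum along every lifted relator is [0] and
   the edges of a Schreier tree have label [0]: such labellings are the
   homomorphisms from [H] to [A]. The conditions form an integer matrix whose
   rows have l1-norm at most [L]. Either it has a nonzero integer solution, that
   is, a nonzero homomorphism from [H] to the integers, which splits [H] as an
   HNN extension of its kernel; or some maximal minor is nonzero, and since it is
   at most [L ^ (n d)], so is the order of every abelian quotient of [H], which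
   contradicts (ii) when [H = G_ i] and the quotient is [G_ i / G_ i.+1]. *)

From HB Require Import structures.
Require Import Defs.
From mathcomp Require Import all_boot all_order all_algebra perm finmap.
From mathcomp Require Import all_classical all_reals all_analysis.
Import Order.TTheory GRing.Theory Num.Theory.
Import numFieldNormedType.Exports.

Local Open Scope classical_set_scope.
Local Open Scope ring_scope.

Set Implicit Arguments.
Unset Strict Implicit.
Unset Printing Implicit Defensive.


(** * Integer systems with bounded rows *)

(** The product of the row sums expands into a sum over all maps from rows to columns. The Leibniz
    terms are those indexed by permutations, and the remaining terms are nonnegative. *)
Lemma ler_det_norm1 (n : nat) (B : 'M[int]_n) (L : nat) :
  (forall i, \sum_j `|B i j| <= L%:Z) -> `|\det B| <= (L ^ n)%:Z.
Proof.
move=> leL; apply: le_trans (ler_norm_sum _ _ _) _.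
under eq_bigr => s _ do rewrite normrM normrX normrN1 expr1n mul1r normr_prod.
have -> : ((L ^ n)%:Z : int) = \prod_(i < n) L%:Z.
  by rewrite prodr_const card_ord -!natz natrX.
apply: le_trans (_ : _ <= \prod_(i < n) \sum_j `|B i j|) _; last first.
  by apply: ler_prod => i _; rewrite leL sumr_ge0.
rewrite bigA_distr_bigA /=.
have -> : \sum_(s : 'S_n) \prod_i `|B i (s i)| =
    \sum_(f in [set pval s | s in [set: 'S_n]]%SET) \prod_i `|B i (f i)|.
  rewrite big_imset; last by move=> s t _ _; exact: val_inj.
  by apply: eq_big => s; rewrite ?inE // => _; apply: eq_bigr => i _; rewrite pvalE.
rewrite big_mkcond /=; apply: ler_sum => f _.
by case: ifP => // _; apply: prodr_ge0.
Qed.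


(** A rational kernel vector becomes an integer one after clearing denominators; hence [M] has full
    column rank over the rationals, and some [n] of its rows are independent. *)
Lemma rowsub_det_neq0 (m n : nat) (M : 'M[int]_(m, n)) :
  (forall v : 'cV[int]_n, M *m v = 0 -> v = 0) ->
  exists f : 'I_n -> 'I_m, \det (rowsub f M) != 0.
Proof.
move=> kerM; pose Mq : 'M[rat]_(m, n) := map_mx intr M.
have fullM : row_full Mq.
  rewrite /row_full -mxrank_tr -/(row_free Mq^T) -kermx_eq0.
  apply/rowV0P => v /sub_kermxP vM.
  (* The vector is read as a polynomial, so that [rat_poly_scale] supplies a common denominator
     [a]. *)
  have [q [a a_neq0 vE]] := rat_poly_scale (rVpoly v).
  have vjE j : v 0 j = a%:~R^-1 * (q`_j)%:~R.
    have := congr1 (fun p : {poly rat} => p`_j) vE.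
    by rewrite /= coef_rVpoly_ord coefZ coef_map.
  have aq_neq0 : a%:~R != 0 :> rat by rewrite intr_eq0.
  have /matrixP q0 : \col_(j < n) q`_j = 0.
    apply: kerM; apply/matrixP => i j; rewrite !mxE; apply: (@intr_inj rat).
    rewrite rmorph_sum /=.
    move/rowP: vM => /(_ i)/(congr1 ( *%R a%:~R)).

    rewrite !mxE mulr0 mulr_sumr => vM; rewrite -[RHS]vM; apply: eq_bigr => k _.
    by rewrite !mxE vjE rmorphM /= mulrA mulVKf // mulrC.
  apply/rowP => j; rewrite vjE mxE.
  by have := q0 j 0; rewrite !mxE => ->; rewrite mulr0.
exists (fullrankfun fullM).
have := fullrowsub_unit fullM.
by rewrite unitmxE unitfE -map_mxsub det_map_mx intr_eq0.
Qed.

Lemma sum_mulrz_row (A : zmodType) (m n : nat) (a : 'I_n -> A)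
    (u : 'rV[int]_m) (B : 'M[int]_(m, n)) :
  \sum_j a j *~ (u *m B) 0 j = \sum_i (\sum_j a j *~ B i j) *~ u 0 i.
Proof.
under eq_bigr => j _ do rewrite mxE mulrz_sumr.
rewrite exchange_big /=; apply: eq_bigr => i _.
rewrite mulrz_suml; apply: eq_bigr => j _.
by rewrite mulrC mulrzA.
Qed.

(** The combinations of the [a j] depend only on [v] modulo the row lattice of [B], whose index is
    the absolute value of the determinant. With a Smith form [B = P D Q], they are the combinations
    of the entries of [b = Q a], and [d_i] kills [b_i]. *)
Lemma square_span_bound (A : zmodType) (n : nat) (B : 'M[int]_n)
    (a : 'I_n -> A) :
  \det B != 0 -> (forall i, \sum_j a j *~ B i j = 0) ->
  exists2 s : seq A, size s = `|\det B|%N &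
    forall v : 'rV[int]_n, \sum_j a j *~ v 0 j \in s.
Proof.
move=> detB aB; have [P uP [Q uQ [d _ BE]]] := int_Smith_normal_form B.
set D := \matrix_(i, j) _ in BE.
have D_diag : D = diag_mx (\row_i d`_i).
  by apply/matrixP => i j; rewrite !mxE.
have absz_unit (U : 'M[int]_n) : U \in unitmx -> `|\det U|%N = 1%N.
  move=> uU; have /(congr1 (absz \o determinant)) := mulmxV uU.
  by rewrite /= det_mulmx det1 abszM => /eqP; rewrite muln_eq1 => /andP[/eqP].
have absdetB : `|\det B|%N = (\prod_(i < n) `|(d`_i)%R|)%N.
  rewrite BE !det_mulmx !abszM (absz_unit P) ?(absz_unit Q) // mul1n muln1.
  rewrite D_diag det_diag.
  rewrite (big_morph absz abszM (erefl _)).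
  by apply: eq_bigr => i _; rewrite mxE.
have d_neq0 (i : 'I_n) : d`_i != 0.
  apply: contraNneq detB => di0; rewrite -absz_eq0 absdetB.
  by rewrite (bigD1 i) //= di0.
pose b i := \sum_j a j *~ Q i j.
have bd (i : 'I_n) : b i *~ d`_i = 0.
  have : \sum_j a j *~ (row i (invmx P) *m B) 0 j = 0.
    by rewrite sum_mulrz_row big1 // => k _; rewrite aB mul0rz.
  rewrite {1}BE -row_mul -!mulmxA mulKmx // D_diag mul_diag_mx => <-.
  rewrite /b mulrz_suml; apply: eq_bigr => j _.
  by rewrite !mxE mulrC mulrzA.
(* One entry for each choice of residues modulo the [d_i], possibly with repetitions: only the
   length matters. *)
pose S := [seq \sum_i b i *~ (g i : nat)%:Z |
  g : {dffun forall i : 'I_n, 'I_`|(d`_i)%R|%N} in predT].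
exists S => [|v].
  rewrite size_image card_dep_ffun absdetB foldrE big_map big_enum /=.
  by apply: eq_bigr => i _; rewrite card_ord.
pose w i := (v *m invmx Q) 0 i.
have -> : \sum_j a j *~ v 0 j = \sum_i b i *~ w i.
  by rewrite -sum_mulrz_row mulmxKV.
have modlt (i : 'I_n) : (`|modz (w i) d`_i| < `|(d`_i)%R|)%N.
  by rewrite -ltz_nat gez0_abs ?modz_ge0 // ltz_mod.
apply/fintype.imageP.
exists [ffun i => Ordinal (modlt i)] => //.
apply: eq_bigr => i _; rewrite ffunE /= gez0_abs ?modz_ge0 //.
rewrite {1}(divz_eq (w i) d`_i) mulrzDr.
by rewrite mulrC mulrzA bd mul0rz add0r.
Qed.

(** Trivial kernel gives a nonzero maximal minor, and [square_span_bound] applies to its rows. The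
    bound [L] on the rows then controls the determinant. *)
Lemma span_bound (A : zmodType) (I J : finType) (M : I -> J -> int) (L : nat)
    (a : J -> A) :
  (forall i, \sum_j `|M i j| <= L%:Z) ->
  (forall v : J -> int, (forall i, \sum_j v j * M i j = 0) -> v =1 fun=> 0) ->
  (forall i, \sum_j a j *~ M i j = 0) ->
  exists2 s : seq A, (size s <= L ^ #|J|)%N &
    forall v : J -> int, \sum_j a j *~ v j \in s.
Proof.
move=> leL kerM aM.
pose Mm := \matrix_(i < #|I|, j < #|J|) M (enum_val i) (enum_val j).
have sumE (B : zmodType) (F : J -> B) :
    \sum_(j < #|J|) F (enum_val j) = \sum_j F j.
  rewrite [RHS](reindex (enum_val : 'I_#|J| -> J)) //.
  by apply: onW_bij; exact: enum_val_bij.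
have [f detB] : exists f : 'I_#|J| -> 'I_#|I|, \det (rowsub f Mm) != 0.
  apply: rowsub_det_neq0 => v Mv0.
  have v0 : (fun j => v (enum_rank j) 0) =1 fun=> 0.
    apply: kerM => i; have /matrixP/(_ (enum_rank i) 0) := Mv0.
    rewrite !mxE => Mv; rewrite -[RHS]Mv -sumE; apply: eq_bigr => j _.
    by rewrite !mxE enum_valK enum_rankK mulrC.
  by apply/colP => j; have := v0 (enum_val j); rewrite enum_valK mxE.
have aB (i : 'I_#|J|) : \sum_j a (enum_val j) *~ rowsub f Mm i j = 0.
  rewrite -[RHS](aM (enum_val (f i))) -sumE.
  by apply: eq_bigr => j _; rewrite !mxE.
have [s sz_s s_span] := square_span_bound detB aB.
exists s => [|v].
  rewrite sz_s -lez_nat abszE; apply: ler_det_norm1 => i.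
  rewrite (le_trans _ (leL (enum_val (f i)))) // -sumE le_eqVlt.
  apply/orP; left.
  by apply/eqP; apply: eq_bigr => j _; rewrite !mxE.
have := s_span (\row_j v (enum_val j)); rewrite -sumE.
by under eq_bigr => j _ do rewrite mxE.
Qed.

(** * Words and presentations *)

Local Open Scope group_scope.

Lemma multiplicative_of (G H : groupType) (f : G -> H) :
  {morph f : x y / x * y} -> exists F : {multiplicative G -> H}, F =1 f.
Proof.
move=> fM; pose m := isMultiplicative.Build G H f fM.
by exists (HB.pack_for {multiplicative G -> H} f m).
Qed.

Lemma groupClosed_of (G : groupType) (P : G -> Prop) :
  P 1 -> (forall x y, P x -> P y -> P (x / y)) ->
  exists H : groupClosed G, forall x, x \in H <-> P x.
Proof.
move=> P1 PF; pose S : {pred G} := fun x => `[< P x >].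
have SP x : x \in S <-> P x by split=> /asboolP.
have PV x : P x -> P x^-1 by move=> Px; rewrite -[x^-1]mul1g; exact: PF.
have m1 : 1 \in S by exact/SP.
have mM : {in S &, forall u v, u * v \in S}.
  by move=> x y /SP Px /SP Py; apply/SP; rewrite -[y]invgK; apply/PF/PV.
have mV : {in S, forall u, u^-1 \in S} by move=> x /SP Px; exact/SP/PV.
by exists (HB.pack_for (groupClosed G) S
  (isMulClosed.Build G S mM) (isMul1Closed.Build G S m1)
  (isInvClosed.Build G S mV)).
Qed.

Lemma multiplicative1 (G H : groupType) (f : {multiplicative G -> H}) : f 1 = 1.
Proof. by apply: (mulgI (f 1)); rewrite -gmulfM !mulg1. Qed.

Lemma multiplicativeV (G H : groupType) (f : {multiplicative G -> H}) :
  {morph f : x / x^-1}.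
Proof.
by move=> x; apply: (mulgI (f x)); rewrite -gmulfM !mulgV multiplicative1.
Qed.

Definition weval (X : choiceType) (K : groupType) (u : X -> K)
    (w : word X) : K :=
  foldr (fun a g => (if a.1 then (u a.2)^-1 else u a.2) * g) 1 w.

Lemma weval_morph (X : choiceType) (K L : groupType) (u : X -> K)
    (f : {multiplicative K -> L}) (w : word X) :
  f (weval u w) = weval (f \o u) w.
Proof.
elim: w => [|[[] x] w IHw] /=; first exact: multiplicative1.
  by rewrite gmulfM multiplicativeV IHw.
by rewrite gmulfM IHw.
Qed.

Lemma weval_cat (X : choiceType) (K : groupType) (u : X -> K) (v w : word X) :
  weval u (v ++ w) = weval u v * weval u w.
Proof. by elim: v => [|a v IHv] /=; rewrite ?mul1g // IHv mulgA. Qed.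

Lemma weval_free_equiv (X : choiceType) (K : groupType) (u : X -> K)
    (v w : word X) :
  free_equiv v w -> weval u v = weval u w.
Proof.
elim=> {v w} // [v w z _ -> _ -> //|v b x w].
by rewrite !weval_cat; case: b => /=; rewrite ?mulKg ?mulVKg.
Qed.

Lemma pi_free_equiv (X : choiceType) (v w : word X) :
  \pi_(free_group X)%qT v = \pi_(free_group X)%qT w <-> free_equiv v w.
Proof.
split=> [/eqP|?]; first by rewrite eqmodE => /asboolP.
by apply/eqP; rewrite eqmodE; exact/asboolP.
Qed.

Lemma free_lift (X : choiceType) (K : groupType) (u : X -> K) :
  exists2 F : {multiplicative free_group X -> K},
    (forall a, F a = weval u (repr a)) & forall x, F (free_gen x) = u x.
Proof.
have ruE (w : word X) : weval u (repr (\pi_(free_group X)%qT w)) = weval u w.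
  by apply: weval_free_equiv; apply/pi_free_equiv; rewrite reprK.
have [|F FE] := @multiplicative_of (free_group X) K (fun a => weval u (repr a)).
  by move=> a b; rewrite ruE weval_cat.
by exists F => // x; rewrite FE ruE /= mulg1.
Qed.

Lemma pi_free_cons (X : choiceType) a (w : word X) :
  \pi_(free_group X)%qT (a :: w) =
  \pi_(free_group X)%qT [:: a] * \pi_(free_group X)%qT w.
Proof.
have catl u v v' : free_equiv v v' -> free_equiv (u ++ v : word X) (u ++ v').
  elim=> {v v'} [v|v v' _|v v' z _ + _|v b x v'];
    [exact: FreeRefl|exact: FreeSym|exact: FreeTrans|].
  by rewrite !catA; exact: FreeCancel.
have catr u v v' : free_equiv v v' -> free_equiv (v ++ u : word X) (v' ++ u).
  elim=> {v v'} [v|v v' _|v v' z _ + _|v b x v'];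
    [exact: FreeRefl|exact: FreeSym|exact: FreeTrans|].
  by rewrite -!catA; exact: FreeCancel.
apply/pi_free_equiv; rewrite -cat1s.
apply: (FreeTrans (catr _ _ _ _) (catl _ _ _ _));
  by apply/pi_free_equiv; rewrite reprK.
Qed.

Lemma weval_free_gen (X : choiceType) (w : word X) :
  weval (@free_gen X) w = \pi_(free_group X)%qT w.
Proof.
elim: w => [//|[b x] w IHw]; rewrite pi_free_cons /= IHw; congr (_ * _).
case: b => //; apply/esym/(mulgI (free_gen x)).
rewrite mulgV -pi_free_cons; apply/pi_free_equiv.
exact: (@FreeCancel X [::] false x [::]).
Qed.

Lemma free_group_ext (X : choiceType) (K : groupType)
    (f g : {multiplicative free_group X -> K}) :
  (forall x, f (free_gen x) = g (free_gen x)) -> f =1 g.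
Proof.
move=> fg a; rewrite -[a]reprK -weval_free_gen !weval_morph.
by congr weval; apply/funext.
Qed.

HB.instance Definition _ (G : groupType) (S : set G) :=
  isMultiplicative.Build G (gquot S) (gquot_pi S) (@gquot_piM G S).

Lemma gquot_pi_eq1 (G : groupType) (S : set G) x : S x -> gquot_pi S x = 1.
Proof.
move=> Sx; rewrite -(multiplicative1 (gquot_pi S)); apply/esym/gquot_piP.
by move=> N _ SN; rewrite invg1 mul1g; exact: SN.
Qed.

(** The kernel of [f] is a normal subgroup containing [S], hence contains its normal closure, so [f]
    is constant on the classes. *)
Lemma gquot_lift (G K : groupType) (S : set G) (f : {multiplicative G -> K}) :
  (forall x, S x -> f x = 1) ->
  exists F : {multiplicative gquot S -> K}, forall x, F (gquot_pi S x) = f x.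
Proof.
move=> fS.
have [|x y fx fy|N NE] := @groupClosed_of G (fun x => f x = 1).
- exact: multiplicative1.
- by rewrite gmulfM multiplicativeV fx fy divgg.
have fpi x y : gquot_pi S x = gquot_pi S y -> f x = f y.
  move=> /gquot_piP/(_ N) xy; apply: (mulgI (f x)^-1).
  rewrite mulVg -multiplicativeV -gmulfM.
  apply/esym/NE/xy; last by move=> z /fS/NE.
  split=> // z h /NE fz _; apply/NE.
  by rewrite /conjg !gmulfM multiplicativeV fz mul1g mulVg.
have [|F FE] := @multiplicative_of (gquot S) K (fun a => f (repr a)).
  move=> a b; rewrite -gmulfM.
  by apply: fpi; rewrite gquot_piM /gquot_pi !reprK.
by exists F => x; rewrite FE; apply: fpi; rewrite /gquot_pi reprK.
Qed.

Lemma gquot_free_ext (X : choiceType) (S : set (free_group X)) (K : groupType)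
    (f g : {multiplicative gquot S -> K}) :
  (forall x, f (gquot_pi S (free_gen x)) = g (gquot_pi S (free_gen x))) ->
  f =1 g.
Proof.
move=> fg a; have [b <-] := gquot_pi_surj a.
exact: (@free_group_ext X K (f \o gquot_pi S) (g \o gquot_pi S)).
Qed.

(** Finite presentability in the form used below: generators, relators as words, and the universal
    property, transported along the isomorphism. The relators are arbitrary representatives of their
    classes, as [weval] respects [free_equiv]. *)
Lemma finitely_presentedP (G : groupType) : finitely_presented G ->
  exists (n : nat) (s : 'I_n -> G) (rs : seq (word 'I_n)),
    [/\ forall g, exists w, weval s w = g,
        forall w, w \in rs -> weval s w = 1
      & forall (K : groupType) (u : 'I_n -> K),
          (forall w, w \in rs -> weval u w = 1) ->
          exists F : {multiplicative G -> K}, forall j, F (s j) = u j].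
Proof.
move=> [n [r [f [g0 fK g0K]]]].
have [g gE] := multiplicative_of (can2_gmulfM fK g0K).
pose s j := g (gquot_pi [set` r] (free_gen j)).
have sE w : weval s w = g (gquot_pi [set` r] (\pi_(free_group 'I_n)%qT w)).
  by rewrite -weval_free_gen !weval_morph.
exists n, s, [seq repr a | a <- r]; split=> [x|w /mapP[a ar ->]|K u uS].
- have [a fa] := gquot_pi_surj (f x).
  by exists (repr a); rewrite sE reprK fa gE fK.
- by rewrite sE reprK gquot_pi_eq1 ?multiplicative1.
have [F FE Fgen] := free_lift u.
have [|E EE] := @gquot_lift _ K [set` r] F.
  by move=> a ar; rewrite FE; apply/uS/map_f.
exists (E \o f) => j; rewrite /= /s.
by rewrite gE g0K EE.
Qed.

(** * Integer characters and HNN extensions *)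

Definition expgz (G : groupType) (x : G) (m : int) : G :=
  match m with Posz n => x ^+ n | Negz n => x ^- n.+1 end.

Lemma expgz_succ (G : groupType) (x : G) m : expgz x (m + 1)%R = x * expgz x m.
Proof.
case: m => [n|[|n]]; first by rewrite -PoszD addn1 /= expgS.
  by rewrite /= expg1 mulgV.
have -> : (Negz n.+1 + 1 = Negz n)%R.
  by rewrite !NegzE -[n.+2]addn1 PoszD opprD addrNK.
by rewrite /expgz [x ^+ n.+2]expgSr invgM mulVKg.
Qed.

(** The equivalence treats both signs at once: in the identities below, the step up multiplies by an
    element or adds one, and the step down cancels it. *)
Lemma int_shift_ind (P : int -> Prop) :
  P 0%R -> (forall m, P m <-> P (m + 1)%R) -> forall m, P m.
Proof.
move=> P0 PS; elim/int_rect => // n IHn.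
  by rewrite -addn1 PoszD; exact/(PS n).
by apply/(PS (- n.+1%:Z)%R); rewrite -addn1 PoszD opprD subrK.
Qed.

Lemma expgzD (G : groupType) (x : G) m k :
  expgz x (m + k)%R = expgz x m * expgz x k.
Proof.
move: m; apply: int_shift_ind => [|m]; first by rewrite add0r mul1g.
by rewrite addrAC !expgz_succ -mulgA; split=> [->|/mulgI].
Qed.

Lemma multiplicative_expgz (G H : groupType) (f : {multiplicative G -> H}) x m :
  f (expgz x m) = expgz (f x) m.
Proof.
move: m; apply: int_shift_ind => [|m]; first exact: multiplicative1.
by rewrite !expgz_succ gmulfM; split=> [->|/mulgI].
Qed.

Section IntegerCharacter.
Variables (H : groupType) (psi : H -> int).
Hypothesis psiM : forall x y, psi (x * y) = (psi x + psi y)%R.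

Lemma int_character1 : psi 1 = 0%R.
Proof. by apply: (addrI (psi 1)); rewrite -psiM mulg1 addr0. Qed.

Lemma int_characterV x : psi x^-1 = (- psi x)%R.
Proof. by apply: (addrI (psi x)); rewrite -psiM mulgV subrr int_character1. Qed.

Lemma int_character_expgz x m : psi (expgz x m) = (m * psi x)%R.
Proof.
move: m; apply: int_shift_ind => [|m]; first by rewrite mul0r int_character1.
by rewrite expgz_succ psiM mulrDl mul1r addrC; split=> [->|/addIr].
Qed.

(* [H] is the semidirect product of [ker psi] by the infinite cyclic group
   generated by [t], hence the ascending HNN extension of [ker psi] along the
   conjugation by [t]. *)
Lemma split_character_hnn (t : H) :
  psi t = 1%R -> nontrivial_graph_of_groups H.
Proof.
move=> psit; right.
have [|x y psix psiy|N NE] := @groupClosed_of H (fun x => psi x = 0%R).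
- exact: int_character1.
- by rewrite psiM int_characterV psix psiy subrr.
have liftN x : psi x = 0%R -> {p : N | val p = x}.
  by move=> /NE xN; exists (Sub x xN); rewrite SubK.
have psiN (p : N) : psi (val p) = 0%R by apply/NE; exact: (valP p).
have tmN (p : N) m : psi (expgz t m * val p / expgz t m) = 0%R.
  by rewrite !psiM int_characterV psiN addr0 subrr.
(* Conjugation by the [m]-th power of [t], restricted to the kernel [N]. *)
pose cj m (p : N) : N := sval (liftN _ (tmN p m)).
have cjE m p : val (cj m p) = expgz t m * val p / expgz t m.
  by rewrite /cj; case: (liftN _ _).
have [|j jE] := @multiplicative_of N N (cj 1%R).
  by move=> p q; apply: val_inj; rewrite cjE !valM !cjE !mulgA mulgVK.
have jtE p : val (j p) = t * val p / t by rewrite jE cjE.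
exists N, N, idfun, j; split => //.
  move=> p q /(congr1 val); rewrite !jtE => /(mulIg t^-1)/(mulgI t).
  exact: val_inj.
pose rel := hnn_relators (@idfun N) j.
pose inP (p : N) : hnn_extension idfun j := gquot_pi rel (free_gen (inl p)).
pose T : hnn_extension idfun j := gquot_pi rel (free_gen (inr tt)).
have inPM p q : inP (p * q) = inP p * inP q.
  apply/esym/divg1_eq; rewrite /inP -gmulfM -multiplicativeV -gmulfM.
  by apply: gquot_pi_eq1; left; exists (p, q).
have Tj p : T * inP p = inP (j p) * T.
  apply: (mulIg T^-1); rewrite mulgK; apply/divg1_eq.
  rewrite /inP -!multiplicativeV -!gmulfM.
  by apply: gquot_pi_eq1; right; exists p.
(* The defining relation of the stable letter, extended to all integer powers; negative ones follow
   by cancelling [T]. *)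
have TcjE m : forall p, expgz T m * inP p = inP (cj m p) * expgz T m.
  move: m; apply: int_shift_ind => [p|m].
    rewrite mul1g mulg1; congr inP; apply: val_inj.
    by rewrite cjE mul1g invg1 mulg1.
  have cjS p : cj (m + 1)%R p = j (cj m p).
    by apply: val_inj; rewrite jtE !cjE expgz_succ invgM !mulgA.
  split=> mE p; have := mE p; rewrite expgz_succ cjS -!mulgA.
    by move=> ->; rewrite !mulgA Tj.
  by rewrite [in RHS]mulgA -Tj -mulgA => /mulgI.
(* Normal form in the semidirect product: [x] is the kernel element [pr x] times the power [psi x]
   of [t]. Replacing [t] by [T] gives the isomorphism [f]. *)
have prN x : psi (x / expgz t (psi x)) = 0%R.
  by rewrite psiM int_characterV int_character_expgz psit mulr1 subrr.
pose pr x : N := sval (liftN _ (prN x)).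
have prE x : val (pr x) = x / expgz t (psi x) by rewrite /pr; case: (liftN _ _).
have [|f fE] := @multiplicative_of H (hnn_extension idfun j)
    (fun x => inP (pr x) * expgz T (psi x)).
  move=> x y; rewrite psiM expgzD !mulgA; congr (_ * _).
  rewrite -!mulgA TcjE !mulgA -inPM; congr (inP _ * _); apply: val_inj.
  rewrite valM cjE !prE psiM expgzD invgM !mulgA.
  by rewrite mulgVK.
have [F _ Fgen] := @free_lift (N + unit)%type H
  (fun z => if z is inl p then val p else t).
have [|g gE] := @gquot_lift _ H rel F.
  move=> _ [[[p q] _ <-]|[p _ <-]]; rewrite !gmulfM !multiplicativeV !Fgen /=.
    by rewrite mulgV.
  by rewrite jtE mulgV.
exists f, g => [x|].
  rewrite fE gmulfM multiplicative_expgz /inP /T !gE !Fgen /=.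
  by rewrite prE mulgVK.
apply: (@gquot_free_ext _ rel _ (f \o g) idfun) => -[p|[]] /=;
  rewrite gE Fgen fE.
  rewrite psiN mulg1; congr inP; apply: val_inj.
  by rewrite prE psiN invg1 mulg1.
rewrite psit -[RHS]mul1g; congr (_ * _).
have -> : pr t = 1 by apply: val_inj; rewrite prE psit mulgV.
by apply: (mulgI (inP 1)); rewrite -inPM !mulg1.
Qed.

End IntegerCharacter.

(** The image of [psi] is generated by its least positive value [k]; dividing by [k] gives a
    character that takes the value 1. *)
Lemma nonzero_character_hnn (H : groupType) (psi : H -> int) :
  (forall x y, psi (x * y) = (psi x + psi y)%R) ->
  (exists x, psi x <> 0%R) -> nontrivial_graph_of_groups H.
Proof.
move=> psiM [x0 psix0].
have ex_pos : exists n, `[< (0 < n)%N /\ exists x, psi x = n%:Z >].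
  exists `|psi x0|%N; apply/asboolP; rewrite absz_gt0; split; first exact/eqP.
  have [le0|/ltW le0] := lerP 0 (psi x0); first by exists x0; rewrite gez0_abs.
  by exists x0^-1; rewrite int_characterV // lez0_abs.
case: (ex_minnP ex_pos) => k /asboolP[k_gt0 [t psit]] k_min.
(* The remainder modulo [k] is itself a value of [psi], so minimality of [k] forces it to vanish. *)
have psi_mod x : psi x = (divz (psi x) k * k)%R.
  rewrite [LHS](divz_eq (psi x) k); apply/eqP; rewrite -subr_eq0 addrC addKr.
  apply: contraT => r_neq0.
  have k_neq0 : k%:Z != 0%R by rewrite eqz_nat -lt0n.
  have : (`|modz (psi x) k| < k)%N.
    by rewrite -ltz_nat gez0_abs ?modz_ge0 // -[ltRHS]ger0_norm // ltz_mod.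
  rewrite ltnNge => /negP; case; apply: k_min.
  apply/asboolP; rewrite absz_gt0; split => //.
  exists (x * expgz t (- divz (psi x) k)%R).
  by rewrite psiM int_character_expgz // psit mulNr gez0_abs ?modz_ge0.
apply: (@split_character_hnn H (fun x => divz (psi x) k) _ t); last first.
  by rewrite psit divzz eqz_nat -lt0n k_gt0.
move=> x y; rewrite psiM [X in divz (X + _)%R]psi_mod divzMDl //.
by rewrite eqz_nat -lt0n.
Qed.

(** * Cocycles on coset graphs *)

Section CocycleGroup.
Variables (X : finType) (V : zmodType).

(* Wreath product of [V] by the permutations of [X]; a homomorphism to it is an
   action on [X] together with a [V]-valued cocycle. *)
Definition cocycle_group := ({perm X} * {ffun X -> V})%type.

HB.instance Definition _ := Choice.on cocycle_group.

Definition cocycle_one : cocycle_group := (1, 0%R).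
Definition cocycle_inv (a : cocycle_group) : cocycle_group :=
  (a.1^-1, [ffun x => - a.2 ((a.1^-1)%g x)]%R).
Definition cocycle_mul (a b : cocycle_group) : cocycle_group :=
  (a.1 * b.1, [ffun x => a.2 x + b.2 (a.1 x)]%R).

Let cocycle_mulA : associative cocycle_mul.
Proof.
move=> a b c; rewrite /cocycle_mul /= mulgA; congr pair.
by apply/ffunP => x; rewrite !ffunE permM addrA.
Qed.

Let cocycle_mul1g : left_id cocycle_one cocycle_mul.
Proof.
move=> [s c]; rewrite /cocycle_mul /= mul1g; congr pair.
by apply/ffunP => x; rewrite !ffunE perm1 add0r.
Qed.

Let cocycle_mulg1 : right_id cocycle_one cocycle_mul.
Proof.
move=> [s c]; rewrite /cocycle_mul /= mulg1; congr pair.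
by apply/ffunP => x; rewrite !ffunE addr0.
Qed.

Let cocycle_mulVg : left_inverse cocycle_one cocycle_inv cocycle_mul.
Proof.
move=> [s c]; rewrite /cocycle_mul /= mulVg; congr pair.
by apply/ffunP => x; rewrite !ffunE addNr.
Qed.

Let cocycle_mulgV : right_inverse cocycle_one cocycle_inv cocycle_mul.
Proof.
move=> [s c]; rewrite /cocycle_mul /= mulgV; congr pair.
by apply/ffunP => x; rewrite !ffunE permK subrr.
Qed.

HB.instance Definition _ := isGroup.Build cocycle_group
  cocycle_mulA cocycle_mul1g cocycle_mulg1 cocycle_mulVg cocycle_mulgV.

Lemma cocycle_mulE (a b : cocycle_group) :
  a * b = (a.1 * b.1, [ffun x => a.2 x + b.2 (a.1 x)]%R).
Proof. by []. Qed.

End CocycleGroup.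

(* [p g] is the coset [H g]; the coset graph has the edges [(x, j)], from [x] to
   [x . s j]. *)
Section CosetGraph.
Variables (G : groupType) (n : nat) (s : 'I_n -> G) (H : groupClosed G).
Variables (X : finType) (p : G -> X) (rep : X -> G).
Hypothesis s_gen : forall g, exists w, weval s w = g.
Hypothesis pP : forall g h, p g = p h <-> g / h \in H.
Hypothesis repK : forall x, p (rep x) = x.

Definition coset_act (x : X) (g : G) : X := p (rep x * g).
Let x0 := p 1.

Lemma coset_act_p g h : coset_act (p g) h = p (g * h).
Proof. by apply/pP; rewrite invgM mulgA mulgK; apply/pP; rewrite repK. Qed.

Lemma coset_act1 x : coset_act x 1 = x.
Proof. by rewrite /coset_act mulg1 repK. Qed.

Lemma coset_actM x g h : coset_act x (g * h) = coset_act (coset_act x g) h.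
Proof. by rewrite -[coset_act x g]/(p (rep x * g)) coset_act_p -mulgA. Qed.

Lemma coset_act_inj g : injective (coset_act^~ g).
Proof.
move=> x y /(congr1 (coset_act^~ g^-1)).
by rewrite -!coset_actM mulgV !coset_act1.
Qed.

Definition letter (a : bool * 'I_n) : G := if a.1 then (s a.2)^-1 else s a.2.

(** An inverse letter read at [x] crosses backwards the edge that ends at [x], which is named after
    its origin. *)
Definition coset_edge (x : X) (a : bool * 'I_n) : X * 'I_n :=
  if a.1 then (coset_act x (s a.2)^-1, a.2) else (x, a.2).

(** The 1-chain of the path that reads [w] from [x]: crossings of [e], counted with sign. *)
Fixpoint trace (x : X) (w : word 'I_n) (e : X * 'I_n) : int :=
  if w is a :: w' then
    ((-1) ^+ a.1 * (e == coset_edge x a)%:R +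
     trace (coset_act x (letter a)) w' e)%R
  else 0%R.

Lemma weval_cons a w : weval s (a :: w) = letter a * weval s w.
Proof. by []. Qed.

Lemma trace_norm1 x w : (\sum_e `|trace x w e| <= (size w)%:Z)%R.
Proof.
elim: w x => [|a w IHw] x /=; first by rewrite big1 // => e _; rewrite normr0.
apply: le_trans (ler_sum _ (fun e _ => ler_normD _ _)) _.
rewrite big_split /= -addn1 addrC PoszD lerD //.
rewrite (bigD1 (coset_edge x a)) //= eqxx mulr1 normrX normrN1 expr1n.
by rewrite big1 ?addr0 // => e /negPf->; rewrite mulr0 normr0.
Qed.

(** Written as a pairing with [trace], so that vanishing along the lifted relators is a linear
    system in [f]. *)
Definition path_sum (A : zmodType) (f : X * 'I_n -> A) (x : X)
    (w : word 'I_n) : A :=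
  (\sum_e f e *~ trace x w e)%R.

Lemma path_sum_nil (A : zmodType) (f : X * 'I_n -> A) x :
  path_sum f x [::] = 0%R.
Proof. by rewrite /path_sum big1. Qed.

Lemma path_sum_cons (A : zmodType) (f : X * 'I_n -> A) x a w :
  path_sum f x (a :: w) =
  ((if a.1 then - f (coset_edge x a) else f (coset_edge x a)) +
   path_sum f (coset_act x (letter a)) w)%R.
Proof.
rewrite /path_sum /=; under eq_bigr => e _ do rewrite mulrzDr.
rewrite big_split /=; congr (_ + _)%R.
rewrite (bigD1 (coset_edge x a)) //= eqxx mulr1 big1 ?addr0; last first.
  by move=> e /negPf->; rewrite mulr0 mulr0z.
by case: a => [[] j] /=; rewrite ?expr1 ?expr0 ?mulrN1z ?mulr1z.
Qed.

(** The edges are labelled by the values of [phi] on the Schreier generators of [H], whose product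
    along a path telescopes. *)
Lemma transversal_path_sum (A : zmodType) (phi : G -> A) (t : X -> G) x w :
  {in H &, forall g h, phi (g * h)%g = (phi g + phi h)%R} ->
  (forall y, p (t y) = y) ->
  path_sum (fun e => phi (t e.1 * s e.2 / t (coset_act e.1 (s e.2)))) x w =
  phi (t x * weval s w / t (coset_act x (weval s w))).
Proof.
move=> phiM tK; have tH y g : t y * g / t (coset_act y g) \in H.
  by apply/pP; rewrite tK -coset_act_p tK.
have phi1 : phi 1 = 0%R.
  by apply: (addrI (phi 1)); rewrite -phiM ?gpred1 // mulg1 addr0.
elim: w x => [|a w IHw] x.
  by rewrite path_sum_nil /= mulg1 coset_act1 mulgV phi1.
rewrite path_sum_cons IHw weval_cons coset_actM.
set y := coset_act x (letter a).
transitivity (phi (t x * letter a / t y)%g +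
    phi (t y * weval s w / t (coset_act y (weval s w)))%g)%R.
  congr (_ + _)%R; case: a @y => [[] j] //=; rewrite /letter /coset_edge /=.
  rewrite -coset_actM mulVg coset_act1.
  (* For an inverse letter, the element to evaluate is the inverse of the Schreier generator of the
     edge from [z] to [x]. *)
  set z := coset_act x _; apply: (addrI (phi (t z * s j / t x)%g)).
  have zsj : coset_act z (s j) = x by rewrite -coset_actM mulVg coset_act1.
  have := tH z (s j); rewrite zsj => zH.
  rewrite subrr -phiM ?tH //.
  by rewrite !mulgA mulgVK mulgK mulgV phi1.
by rewrite -phiM ?tH // !mulgA mulgVK.
Qed.

(** A breadth-first spanning tree rooted at [x0]: [parent x] drops the last letter of a shortest
    word leading to [x], and [t x] multiplies the letters along the tree path. The strict decrease
    of [dist] permits induction along the tree. *)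
Lemma schreier_transversal :
  exists (t : X -> G) (parent : X -> option (X * (bool * 'I_n)))
    (dist : X -> nat),
    [/\ t x0 = 1, forall x, p (t x) = x
      & forall x, if parent x is Some (y, a) then
          [/\ (dist y < dist x)%N, coset_act y (letter a) = x
            & t x = t y * letter a]
        else x = x0].
Proof.
have reach x : exists k,
    `[< exists2 w, size w = k & coset_act x0 (weval s w) = x >].
  have [w wE] := s_gen (rep x); exists (size w); apply/asboolP; exists w => //.
  by rewrite wE coset_act_p mul1g repK.
pose dist x := ex_minn (reach x).
have distP x : exists2 w, size w = dist x & coset_act x0 (weval s w) = x.
  by rewrite /dist; case: ex_minnP => k /asboolP.
have dist_min x w : coset_act x0 (weval s w) = x -> (dist x <= size w)%N.
  rewrite /dist; case: ex_minnP => k _ k_min wx.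
  by apply/k_min/asboolP; exists w.
have ex_parent x : exists q : option (X * (bool * 'I_n)),
    if q is Some (y, a) then dist x = (dist y).+1 /\ coset_act y (letter a) = x
    else x = x0.
  have [w sz_w wx] := distP x; case/lastP: w sz_w wx => [|w a] sz_w wx.
    by exists None; rewrite -wx coset_act1.
  have rconsE v : weval s (rcons v a) = weval s v * letter a.
    by rewrite -cats1 weval_cat /= mulg1.
  pose y := coset_act x0 (weval s w).
  have yx : coset_act y (letter a) = x by rewrite -coset_actM -rconsE.
  exists (Some (y, a)); split => //.
  apply/eqP; rewrite eqn_leq -{2}sz_w size_rcons ltnS dist_min // andbT.
  have [v <- vy] := distP y.
  by rewrite -(size_rcons v a) dist_min // rconsE coset_actM vy.
have [parent parentP] := choice ex_parent.
(* Recursion on the fuel [k]; the fuel [dist x] is exactly the depth of [x] in the tree. *)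
pose T := fix T k x : G := if k is k'.+1 then
  (if parent x is Some (y, a) then T k' y * letter a else 1) else 1.
exists (fun x => T (dist x) x), parent, dist; split.
- have : (dist x0 <= 0)%N by apply: (dist_min x0 [::]); rewrite coset_act1.
  by rewrite leqn0 => /eqP->.
- move=> x; move: {2}(dist x) (erefl (dist x)) => k; elim: k x => [|k IHk] x xk.
    by have := parentP x; rewrite xk; case: (parent x) => [[y a] []|].
  have := parentP x; rewrite xk /=; case: (parent x) => [[y a] [[yk] <-]|->//].
  by rewrite -coset_act_p yk IHk.
- move=> x; have := parentP x; case E: (parent x) => [[y a]|//] [xy ayx].
  by rewrite xy ltnS leqnn; split => //=; rewrite E.
Qed.

(** Sending each generator to its permutation of [X] together with its labels kills the relators in
    the wreath product, hence extends to [G]. Path sums thus depend only on the element that a word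
    represents. *)
Lemma path_sum_cocycle (A : zmodType) (f : X * 'I_n -> A)
    (rs : seq (word 'I_n)) :
  (forall (K : groupType) (u : 'I_n -> K),
     (forall w, w \in rs -> weval u w = 1) ->
     exists F : {multiplicative G -> K}, forall j, F (s j) = u j) ->
  (forall w, w \in rs -> weval s w = 1) ->
  (forall x w, w \in rs -> path_sum f x w = 0%R) ->
  exists c : X -> G -> A,
    (forall x g h, c x (g * h) = (c x g + c (coset_act x g) h)%R) /\
    (forall x w, c x (weval s w) = path_sum f x w).
Proof.
move=> rs_univ rs1 f_rs.
pose u j : cocycle_group X A :=
  (perm (@coset_act_inj (s j)), [ffun x => f (x, j)]).
have uE w : (forall x, (weval u w).1 x = coset_act x (weval s w)) /\
            (forall x, (weval u w).2 x = path_sum f x w).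
  elim: w => [|a w [IH1 IH2]].
    by split=> x; rewrite ?perm1 ?coset_act1 // ffunE path_sum_nil.
  have a1 x : (if a.1 then (u a.2)^-1 else u a.2).1 x = coset_act x (letter a).
    case: a => [[] j] /=; rewrite /letter /=; last by rewrite permE.
    apply: (@perm_inj _ (perm (@coset_act_inj (s j)))).
    by rewrite permKV permE -coset_actM mulVg coset_act1.
  have a2 x : (if a.1 then (u a.2)^-1 else u a.2).2 x =
      (if a.1 then - f (coset_edge x a) else f (coset_edge x a))%R.
    case: a a1 => [[] j] /= a1; rewrite /letter /coset_edge /=; last first.
      by rewrite ffunE.
    by rewrite ffunE a1 ffunE.
  split=> x; rewrite [weval u _]/= cocycle_mulE /=.
    by rewrite permM a1 IH1 -coset_actM.
  by rewrite ffunE a1 a2 IH2 path_sum_cons.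
have u_rs1 w : w \in rs -> weval u w = 1.
  move=> w_rs.
  rewrite [weval u w]surjective_pairing; have [w1 w2] := uE w.
  congr pair; [apply/permP => x|apply/ffunP => x].
    by rewrite w1 rs1 // coset_act1 perm1.
  by rewrite w2 f_rs // ffunE.
have [F FE] := rs_univ (cocycle_group X A) u u_rs1.
have FwE w : F (weval s w) = weval u w.
  by rewrite weval_morph; congr weval; apply/funext.
exists (fun x g => (F g).2 x); split=> [x g h|x w]; last first.
  by rewrite FwE (uE w).2.
rewrite gmulfM cocycle_mulE ffunE; have [w <-] := s_gen g.
by rewrite FwE (uE w).1.
Qed.

(** Characters of [H] are taken as functions on [G] that are additive on [H]. The bound depends
    neither on [A] nor on [phi]; positivity of [L] accounts for the tree rows, of norm at most 1. *)
Lemma character_or_bound (rs : seq (word 'I_n)) (L : nat) :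
  (forall (K : groupType) (u : 'I_n -> K),
     (forall w, w \in rs -> weval u w = 1) ->
     exists F : {multiplicative G -> K}, forall j, F (s j) = u j) ->
  (forall w, w \in rs -> weval s w = 1) ->
  (0 < L)%N -> (forall w, w \in rs -> (size w <= L)%N) ->
  (exists2 psi : G -> int,
     {in H &, forall g h, psi (g * h)%g = (psi g + psi h)%R}
     & exists2 h, h \in H & psi h <> 0%R) \/
  (forall (A : zmodType) (phi : G -> A),
     {in H &, forall g h, phi (g * h)%g = (phi g + phi h)%R} ->
     exists2 S : seq A, (size S <= L ^ (#|X| * n))%N
       & forall h, h \in H -> phi h \in S).
Proof.
move=> rs_univ rs1 L_gt0 rsL.
have [no_psi|] := pselect (forall psi : G -> int,
    {in H &, forall g h, psi (g * h)%g = (psi g + psi h)%R} ->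
    {in H, forall h, psi h = 0%R}); last first.
  move=> /existsNP[psi /not_implyP[psiM /existsNP[h /not_implyP[hH psih]]]].
  by left; exists psi => //; exists h.
right=> A phi phiM.
have [t [parent [dist [t1 tK parentP]]]] := schreier_transversal.
(* One row for each relator lifted at each vertex, and one for the tree edge into each vertex; the
   root gets a zero row. *)
pose M (i : X * 'I_(size rs) + X) (e : X * 'I_n) : int := match i with
  | inl (x, k) => trace x (tnth (in_tuple rs) k) e
  | inr x => if parent x is Some (y, a) then (e == coset_edge y a)%:R%R else 0%R
  end.
have M_rs (B : zmodType) (f : X * 'I_n -> B) :
    (forall i, \sum_e f e *~ M i e = 0)%R ->
    forall x w, w \in rs -> path_sum f x w = 0%R.
  move=> fM x w /(nthP [::])[k k_lt wk]; have := fM (inl (x, Ordinal k_lt)).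
  by rewrite /M (tnth_nth [::]) /= wk.
have M_tree (B : zmodType) (f : X * 'I_n -> B) x y a : parent x = Some (y, a) ->
    (\sum_e f e *~ M (inr x) e = f (coset_edge y a))%R.
  move=> xy; rewrite /M xy (bigD1 (coset_edge y a)) //= eqxx mulr1z.
  by rewrite big1 ?addr0 // => e /negPf->; rewrite mulr0z.
have card_e : (#|X| * n)%N = #|{: X * 'I_n}| by rewrite card_prod card_ord.
pose f (e : X * 'I_n) := phi (t e.1 * s e.2 / t (coset_act e.1 (s e.2))).
have phi1 : phi 1 = 0%R.
  by apply: (addrI (phi 1)); rewrite -phiM ?gpred1 // mulg1 addr0.
have [|||S sz_S S_span] := @span_bound A _ _ M L f.
- move=> [[x k]|x].
    rewrite (le_trans (trace_norm1 _ _)) // lez_nat rsL //.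
    exact: mem_tnth.
  rewrite /M; case: (parent x) => [[y a]|]; last first.
    by rewrite big1 // => e _; rewrite normr0.
  rewrite (bigD1 (coset_edge y a)) //= eqxx normr1 big1 ?addr0 //.
  by move=> e /negPf->; rewrite normr0.
- move=> v vM.
  have {}vM i : (\sum_e v e *~ M i e = 0)%R.
    by rewrite -[RHS](vM i); apply: eq_bigr => e _; rewrite mulrzz.
  (* A kernel vector [v] yields a cocycle [c]. On [H], [c x0] is an integer character, hence zero;
     the tree rows make it vanish on the transversal too. *)
  have [c [cM cE]] := path_sum_cocycle rs_univ rs1 (M_rs _ v vM).
  have x0H h : h \in H -> coset_act x0 h = x0.
    by move=> hH; rewrite coset_act_p mul1g; apply/pP; rewrite invg1 mulg1.
  have c0 : {in H, forall h, c x0 h = 0%R}.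
    by apply: no_psi => g h gH hH; rewrite cM x0H.
  have cgen x a : c x (letter a) =
      (if a.1 then - v (coset_edge x a) else v (coset_edge x a))%R.
    by rewrite -[letter a]mulg1 -[1]/(weval s [::]) -weval_cons cE path_sum_cons
       path_sum_nil addr0.
  have ct x : c x0 (t x) = 0%R.
    move: {2}(dist x).+1 (ltnSn (dist x)) => k; elim: k x => // k IHk x xk.
    have := parentP x; case E: (parent x) => [[y a]|]; last first.
      by move=> ->; rewrite t1 c0 ?gpred1.
    move=> [yx _ ->]; rewrite cM IHk ?(leq_trans yx) // add0r coset_act_p mul1g tK.
    by rewrite cgen -(M_tree _ v x) // vM oppr0; case: a.1.
  move=> [x j]; transitivity (c x (s j)).
    by rewrite -[s j]/(letter (false, j)) cgen.
  (* Expanding [c x0] on [h * t (coset_act x (s j))], which is [t x * s j], isolates [c x (s j)],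
     the label of the edge [(x, j)]. *)
  pose h := t x * s j / t (coset_act x (s j)).
  have hH : h \in H by apply/pP; rewrite tK -coset_act_p tK.
  have := cM x0 h (t (coset_act x (s j))).
  rewrite (x0H h hH) (c0 h hH) ct /h mulgVK cM ct add0r coset_act_p mul1g tK addr0.
  exact.
(* The labels coming from [phi] solve the system: a lifted relator is a loop representing 1, and the
   Schreier generator of a tree edge is 1. *)
- move=> [[x k]|x].
    rewrite -[LHS]/(path_sum f x (tnth (in_tuple rs) k)).
    rewrite (transversal_path_sum x _ phiM tK) rs1 ?coset_act1 ?mulg1 ?mulgV //.
    exact: mem_tnth.
  have := parentP x; case E: (parent x) => [[y a]|]; last first.
    by move=> _; rewrite big1 // => e _; rewrite /M E mulr0z.
  move=> [_ ayx tx].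
  rewrite (M_tree _ _ _ _ _ E) /f; case: a ayx tx {E} => [[] j] /=; rewrite /letter /=.
    rewrite /coset_edge /= => ayx tx; rewrite ayx -{2}ayx -coset_actM mulVg coset_act1.
    by rewrite tx mulgVK mulgV.
  by rewrite /coset_edge /= => -> ->; rewrite mulgV.
exists S => [|h hH]; first by rewrite card_e.
have [w wh] := s_gen h.
have x0h : coset_act x0 h = x0.
  by rewrite coset_act_p mul1g; apply/pP; rewrite invg1 mulg1.
(* A word for [h] in [H] is a loop at [x0], along which the labels add up to [phi h]. *)
have := transversal_path_sum x0 w phiM tK.
by rewrite wh x0h t1 mul1g invg1 mulg1 => <-; exact: S_span.
Qed.

End CosetGraph.

(** * Abelian quotients and counting of cosets *)

Section AdditiveNotation.
Variable Q : groupType.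

(** The proof of commutativity is kept as a parameter of the type, so that the [zmodType] structure
    can be attached to it. *)
Definition additive_of (abQ : abelian_group Q) : Type := Q.

Variable abQ : abelian_group Q.

HB.instance Definition _ := Choice.copy (additive_of abQ) Q.
HB.instance Definition _ := GRing.isZmodule.Build (additive_of abQ)
  (@mulgA Q) abQ (@mul1g Q) (@mulVg Q).
End AdditiveNotation.

Lemma lcoset_eqP (G : groupType) (H : groupClosed G) x y :
  [set x * k | k in [set` H]] = [set y * k | k in [set` H]] <-> x^-1 * y \in H.
Proof.
split=> [xy|xyH].
  have : [set x * k | k in [set` H]] y
    by rewrite xy; exists 1; rewrite ?mulg1 //=; exact: gpred1.
  by move=> [k kH <-]; rewrite mulKg.
apply/seteqP; split=> _ [k kH <-].
  exists ((x^-1 * y)^-1 * k); last by rewrite invgM invgK -!mulgA mulVKg.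
  by rewrite /= gpredM ?gpredV.
exists (x^-1 * y * k); last by rewrite !mulgA mulgV mul1g.
by rewrite /= gpredM.
Qed.

(** Inversion turns the right cosets of the coset graph into the left cosets counted by
    [subgroup_index]: [p g] is the left coset of [g^-1]. *)
Lemma finite_index_cosets (G : groupType) (H : groupClosed G) :
  finite_index H ->
  exists (X : finType) (p : G -> X) (rep : X -> G),
    [/\ #|X| = subgroup_index predT H,
        forall g h, p g = p h <-> g / h \in H & forall x, p (rep x) = x].
Proof.
move=> finH; pose C := fset_set (lcosets predT H).
have gC g : [set g^-1 * k | k in [set` H]] \in C.
  by rewrite in_fset_set // inE; exists g^-1.
pose p g : C := [` gC g]%fset.
have [|rep repK] := @choice C G (fun x g => p g = x).
  move=> x; have := valP x; rewrite in_fset_set // inE => -[g _ gx].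
  by exists g^-1; apply: val_inj; rewrite /= invgK.
exists C, p, rep; split=> // [|g h]; first by rewrite -cardfE.
rewrite -[h in g / h]invgK invgK -{2}[g]invgK -lcoset_eqP.
by split=> [/(congr1 val)|gh]; last exact: val_inj.
Qed.

(** Each left coset of [K] in [H] is recovered from a representative of its class in the quotient,
    so the list [S] yields all of them; this also shows that they are finitely many. *)
Lemma subgroup_index_le (G : groupType) (H K : groupClosed G) :
  {in K & H, forall x h, x ^ h \in K} ->
  forall S : seq (subquotient H K),
  (forall h : H, gquot_pi [set x : H | val x \in K] h \in S) ->
  (subgroup_index H K <= size S)%N.
Proof.
move=> nKH S S_all; pose coset_of (a : subquotient H K) : set G :=
  [set val (repr a) * k | k in [set` K]].
have [N NE] : exists N : groupClosed H, forall x, x \in N <-> val x \in K.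
  apply: (@groupClosed_of H (fun x => val x \in K)) => [|x y xK yK].
    by rewrite val1 gpred1.
  by rewrite valM gmulfV gpredF.
have cosetS : lcosets H K `<=` [set` [seq coset_of a | a <- S]].
  move=> _ [h hH <-] /=; apply/mapP.
  pose h' : H := Sub h hH; exists (gquot_pi _ h'); first exact: S_all h'.
  apply/lcoset_eqP; set y := repr _.
  have /gquot_piP/(_ N) : gquot_pi [set x : H | val x \in K] h' = gquot_pi _ y.
    by rewrite /y [RHS]reprK.
  move=> hy; have /NE : h'^-1 * y \in N.
    apply: hy => [|x /NE//].
    by split=> // x g /NE xK _; apply/NE; rewrite !valM gmulfV;
      exact/nKH/(valP g).
  by rewrite valM gmulfV.
rewrite -(size_map coset_of) /subgroup_index.
apply: uniq_leq_size; first exact: fset_uniq.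
move=> c; rewrite in_fset_set; last exact: (sub_finite_set cosetS).
by rewrite inE => /cosetS.
Qed.

Local Open Scope ring_scope.

Theorem theorem5p1 (R : realType) (G : groupType)
  (G_ : nat -> groupClosed G)
  (G_fp : finitely_presented G)
  (G_finite_index : forall i, finite_index (G_ i))
  (G_decr : forall i, {subset G_ i.+1 <= G_ i})
  (G_normal : forall i, normal_in (G_ i) (G_ 0%N))
  (G_abelian : forall i, abelian_group (subquotient (G_ i) (G_ i.+1)))
  (G_index : (fun i => ln (subgroup_index (G_ i) (G_ i.+1))%:R /
                       (subgroup_index predT (G_ i))%:R : R) @ \oo --> +oo)
  (G_rank : (0 < limn_esup (fun i =>
     ((grank (subquotient (G_ i) (G_ i.+1)))%:R /
      (subgroup_index predT (G_ i))%:R : R)%:E))%E) :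
  \forall i \near \oo, nontrivial_graph_of_groups (G_ i).
Proof.
have [n [s [rs [s_gen rs1 rs_univ]]]] := finitely_presentedP G_fp.
(* The successor keeps [L] positive, and thus [ln L%:R] nonnegative, even without relators. *)
pose L := (\max_(w <- rs) size w).+1.
have rsL w : w \in rs -> (size w <= L)%N.
  by move=> w_rs; apply/leqW/leq_bigmax_seq.
(* With [d] the index of [G_ i], a bound [idx <= L ^ (d * n)] would give a ratio of at most
   [n * ln L]. *)
have /cvgryPgt/(_ (n%:R * ln L%:R)) := G_index.
apply: filterS => i; set idx := subgroup_index _ (G_ i.+1) => idx_gt.
have [X [p [rep [cardX pP repK]]]] := finite_index_cosets (G_finite_index i).
have [[psi psiM [h hG psih]]|bound] :=
    character_or_bound s_gen pP repK rs_univ rs1 (ltn0Sn _) rsL.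
  apply: (@nonzero_character_hnn _ (fun x : G_ i => psi (val x))).
    by move=> x y; rewrite valM psiM //; exact: valP.
  by exists (Sub h hG); rewrite SubK.
pose pi_ := gquot_pi [set x : G_ i | val x \in G_ i.+1].
(* [insubd] extends the projection of [G_ i] to all of [G], sending outside elements to the class of
   1. *)
have [|S sz_S S_all] :=
    bound (additive_of (G_abelian i)) (fun g => pi_ (insubd 1%g g)).
  move=> g h gG hG; rewrite -[RHS]gquot_piM; congr pi_; apply: val_inj.
  by rewrite valM !insubdK ?gpredM.
have idx_le : (idx <= L ^ (#|X| * n))%N.
  apply: leq_trans (subgroup_index_le _ _) sz_S; last first.
    by move=> h; have := S_all (val h) (valP h); rewrite valKd.
  move=> x h xK hH; apply: (G_normal i.+1).2 => //.
  have G0 m : {subset G_ m <= G_ 0%N}.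
    by elim: m => // m IHm y /G_decr/IHm.
  exact: G0 hH.
have d_gt0 : (0 < #|X|)%N by apply/card_gt0P; exists (p 1%g).
move: idx_gt; rewrite -cardX ltr_pdivlMr ?ltr0n // ltNge => /negP[].
(* For [idx = 0] the convention [ln 0 = 0] settles the inequality, its other side being
   nonnegative. *)
have [->|idx_gt0] := posnP idx.
  by rewrite ln0 // mulr_ge0 ?mulr_ge0 ?ln_ge0 ?ler1n.
rewrite (le_trans (_ : _ <= ln ((L ^ (#|X| * n))%:R : R))) //.
  by rewrite ler_ln ?posrE ?ltr0n ?expn_gt0 // ler_nat.
rewrite natrX lnXn ?ltr0n // -[ln _ *+ _]mulr_natl natrM.
by rewrite [_ * n%:R]mulrC mulrAC.
Qed.
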